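(* Let $\mathfrak X$ be a homogeneous tree of degree $q+1$ ($q\geq1$), and let $s,t$ be positive real numbers with $s+t=1$. Let $\{f_k\}_{k\geq0}$ be a sequence in $\mathcal F(\mathfrak X)$ satisfying the generalized Euler–Poisson–Darboux equation $\mu_1f_k=s\,f_{k+1}+t\,f_{k-1}$ for all $k\geq1$. Then for every $k\geq 0$, $$f_k=\left(\sqrt{\tfrac ts}\right)^k\left[\sqrt{\tfrac st}\,U_{k-1}\!\left(\tfrac{1}{2\sqrt{st}}\mu_1\right)f_1-U_{k-2}\!\left(\tfrac{1}{2\sqrt{st}}\mu_1\right)f_0\right].$$
   Context: $\mathfrak X$ is a tree in which every vertex has exactly $q+1$ edges; $\mathcal F(\mathfrak X)$ is the space of complex-valued functions on its vertices; $\mu_1f(v)=\frac{1}{q+1}\sum_{w\text{ adjacent to }v}f(w)$. $U_n$: Chebyshev polynomials of the second kind, $U_0=1$, $U_1(x)=2x$, $U_n=2xU_{n-1}-U_{n-2}$, with $U_{-n-1}=-U_{n-1}$ for $n\geq0$ (so $U_{-1}=0$, $U_{-2}=-1$); polynomials are applied to the operator $\mu_1$; square roots are positive. *)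

(* Defs.v *)
From HB Require Import structures.
From mathcomp Require Import all_boot all_order all_algebra.
From mathcomp Require Import all_classical reals.
From mathcomp Require Import complex.

Set Implicit Arguments.
Unset Strict Implicit.
Unset Printing Implicit Defensive.

Import Order.TTheory GRing.Theory Num.Theory.

Local Open Scope classical_set_scope.
Local Open Scope card_scope.
Local Open Scope ring_scope.

Definition neighbors (V : choiceType) (adj : rel V) (v : V) : set V :=
  [set w | adj v w].

Definition is_tree (V : choiceType) (adj : rel V) : Prop :=
  [/\ symmetric adj, irreflexive adj,
      (forall u v : V, exists2 p : seq V, path adj u p & last u p = v)
    & forall c : seq V, ucycle adj c -> (size c <= 2)%N].
(* [ucycle] counts [:: v; w] with [adj v w] as a closed path (an edge there
   and back); a genuine circuit has at least three vertices. *)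

Definition homogeneous_tree (q : nat) (V : choiceType) (adj : rel V) : Prop :=
  is_tree adj /\ forall v : V, neighbors adj v #= `I_q.+1.

(* The sum is over a finite set whenever [homogeneous_tree q adj] holds. *)
Definition mu1 (K : fieldType) (q : nat) (V : choiceType) (adj : rel V)
    (f : V -> K) : V -> K :=
  fun v => (q.+1)%:R^-1 * \sum_(w \in neighbors adj v) f w.

Fixpoint chebU_nat {K : comNzRingType} (n : nat) : {poly K} :=
  if n is m.+1 then
    if m is l.+1 then 'X *+ 2 * chebU_nat m - chebU_nat l
    else 'X *+ 2
  else 1.

(* [Negz n] is [- n - 1], and the extension is U_(-n-1) = - U_(n-1); for n = 0
   this reads U_(-1) = - U_(-1), hence 0. *)
Definition chebU {K : comNzRingType} (n : int) : {poly K} :=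
  match n with
  | Posz m => chebU_nat m
  | Negz 0 => 0
  | Negz m.+1 => - chebU_nat m
  end.

(* p(T) for an operator T; [horner_alg] does not apply since the endomorphisms
   of an infinite-dimensional module carry no algebra instance. *)
Definition poly_op (K : comNzRingType) (E : lmodType K) (p : {poly K})
    (T : E -> E) : E -> E :=
  fun x => \sum_(i < size p) p`_i *: iter i T x.

(* Main.v *)
(* The rescaled sequence g k = (s / t) ^ (k / 2) f k satisfies the Chebyshev
   recurrence g (k + 2) = 2 T g (k + 1) - g k with T = mu1 / (2 sqrt (s t)),
   and so does the combination U_(k-1)(T) g 1 - U_(k-2)(T) g 0, which has the
   same first two terms. *)
From HB Require Import structures.
Require Import Defs.
From mathcomp Require Import all_boot all_order all_algebra.
From mathcomp Require Import all_classical reals.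
From mathcomp Require Import complex.
From mathcomp Require Import ring zify.

Import Order.TTheory GRing.Theory Num.Theory.
Local Open Scope complex_scope.
Local Open Scope ring_scope.

(** The sign rule for negative indices is what carries the recurrence through zero. The cases 0, -1
    and -2, where the branches of [chebU] meet, are checked separately. *)
Lemma chebU_rec (K : comNzRingType) (n : int) :
  chebU (n + 1) = 'X *+ 2 * chebU n - chebU (n - 1) :> {poly K}.
Proof.
case: n => [[|m]|[|[|m]]].
- by rewrite /= mulr1 subr0.
- have -> : m.+1%:Z + 1 = m.+2 by lia.
  by have -> : m.+1%:Z - 1 = m by lia.
- by rewrite /= mulr0 sub0r opprK.
- by rewrite /= mulrN mulr1 opprK addNr.
- have -> : Negz m.+2 + 1 = Negz m.+1 by lia.
  have -> : Negz m.+2 - 1 = Negz m.+3 by lia.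
  by rewrite /= mulrN opprK addKr.
Qed.

Section PolyOp.

Variables (K : comNzRingType) (E : lmodType K) (T : {linear E -> E}).
Implicit Types (p r : {poly K}) (x y : E).

(** Sizes change under addition and under multiplication by ['X], so coefficientwise arguments need
    a common range, padded with zero coefficients. *)
Lemma poly_op_widen n p x : (size p <= n)%N ->
  poly_op p T x = \sum_(i < n) p`_i *: iter i T x.
Proof.
move=> le_pn; rewrite /poly_op (big_ord_widen n (fun i => p`_i *: iter i T x)) //.
rewrite big_mkcond; apply: eq_bigr => i _.
by case: ltnP => // le_pi; rewrite nth_default // scale0r.
Qed.

Lemma poly_op0 x : poly_op 0 T x = 0.
Proof. by rewrite /poly_op size_poly0 big_ord0. Qed.

Lemma poly_op1 x : poly_op 1 T x = x.
Proof. by rewrite /poly_op size_poly1 big_ord1 coef1 scale1r. Qed.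

Lemma poly_opN p x : poly_op (- p) T x = - poly_op p T x.
Proof.
rewrite /poly_op size_polyN -sumrN; apply: eq_bigr => i _.
by rewrite coefN scaleNr.
Qed.

Lemma poly_opD p r x :
  poly_op (p + r) T x = poly_op p T x + poly_op r T x.
Proof.
pose n := maxn (size p) (size r).
rewrite (@poly_op_widen n (p + r)) ?size_polyD //.
rewrite (@poly_op_widen n p) ?leq_maxl // (@poly_op_widen n r) ?leq_maxr //.
by rewrite -big_split; apply: eq_bigr => i _; rewrite coefD scalerDl.
Qed.

Lemma poly_opXM p x : poly_op ('X * p) T x = T (poly_op p T x).
Proof.
rewrite (@poly_op_widen (size p).+1); last first.
  by rewrite (leq_trans (size_polyMleq _ _)) // size_polyX.
rewrite big_ord_recl coefXM scale0r add0r linear_sum.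
by apply: eq_bigr => i _; rewrite coefXM linearZ.
Qed.

Lemma poly_opZ p a x : poly_op p T (a *: x) = a *: poly_op p T x.
Proof.
rewrite /poly_op scaler_sumr; apply: eq_bigr => i _.
have -> : iter i T (a *: x) = a *: iter i T x.
  by elim: (i : nat) => //= n ->; rewrite linearZ.
by rewrite !scalerA mulrC.
Qed.

Lemma poly_op_chebU_rec (n : int) x :
  poly_op (chebU (n + 1)) T x =
  T (poly_op (chebU n) T x) *+ 2 - poly_op (chebU (n - 1)) T x.
Proof.
by rewrite chebU_rec mulrnAl mulr2n !poly_opD poly_opN poly_opXM -mulr2n.
Qed.

Lemma chebyshev_recurrence (g : nat -> E) :
  (forall k, g k.+2 = T (g k.+1) *+ 2 - g k) ->
  forall k : nat, g k = poly_op (chebU (k%:Z - 1)) T (g 1%N)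
                      - poly_op (chebU (k%:Z - 2)) T (g 0%N).
Proof.
(* The recurrence has order two, so the induction carries two consecutive indices. *)
move=> g_rec k; suff [] : let h (k : nat) :=
    poly_op (chebU (k%:Z - 1)) T (g 1%N)
    - poly_op (chebU (k%:Z - 2)) T (g 0%N) in
  g k = h k /\ g k.+1 = h k.+1 by [].
move=> h; have h_rec j : h j.+2 = T (h j.+1) *+ 2 - h j.
  (* The indices are centred at j and j - 1; for j = 0 the second centre is -1, so the recurrence is
     needed at a negative index. *)
  have e1 : j.+2%:Z - 1 = j.+1%:Z - 1 + 1 by lia.
  have e2 : j.+2%:Z - 2 = j.+1%:Z - 2 + 1 by lia.
  have e3 : j%:Z - 1 = j.+1%:Z - 1 - 1 by lia.
  have e4 : j%:Z - 2 = j.+1%:Z - 2 - 1 by lia.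
  rewrite /h e1 e2 e3 e4 !poly_op_chebU_rec [T (_ - _)]linearB mulrnBl.
  by rewrite !opprD !opprK addrACA.
elim: k => [|k [IHk IHk1]]; last by rewrite g_rec h_rec -IHk -IHk1.
(* The initial values come from U_(-2) = -1, U_(-1) = 0 and U_0 = 1. *)
by rewrite /h /= poly_opN poly_op0 !poly_op1 poly_op0 opprK subr0 add0r.
Qed.

(** Here [s] and [t] stand for the original coefficients divided by 2 sqrt(st), that is b/2 and
    1/(2b) with b = sqrt(s/t). The two identities on [b] make b^k f_k satisfy the Chebyshev
    recurrence without any division or square root. *)
Lemma euler_poisson_darboux (b s t : K) (f : nat -> E) :
  s *+ 2 = b -> b * t *+ 2 = 1 ->
  (forall k, T (f k.+1) = s *: f k.+2 + t *: f k) ->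
  forall k : nat, b ^+ k *: f k =
    b *: poly_op (chebU (k%:Z - 1)) T (f 1%N)
    - poly_op (chebU (k%:Z - 2)) T (f 0%N).
Proof.
move=> sb bt f_rec k.
have g_rec j : b ^+ j.+2 *: f j.+2 =
    T (b ^+ j.+1 *: f j.+1) *+ 2 - b ^+ j *: f j.
  have bjt : b ^+ j.+1 * t *+ 2 = b ^+ j.
    by rewrite exprSr -mulrA -mulrnAr bt mulr1.
  rewrite linearZ /= f_rec scalerDr !scalerA mulrnDl !scalerMnl bjt.
  by rewrite -mulrnAr sb -exprSr addrK.
rewrite (@chebyshev_recurrence (fun j => b ^+ j *: f j) g_rec k).
by rewrite expr1 expr0 scale1r poly_opZ.
Qed.

End PolyOp.

(** Finiteness matters because [\sum_(w \in A)] takes the default value 0 on infinite support, which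
    can break additivity. *)
Lemma mu1_linear (K : fieldType) (q : nat) (V : choiceType) (adj : rel V)
    (a : K) (g h : V -> K) (v : V) : finite_set (neighbors adj v) ->
  mu1 q adj (fun w => a * g w + h w) v = a * mu1 q adj g v + mu1 q adj h v.
Proof.
move=> fin_nbh; rewrite /mu1 !fsbig_finite //= big_split /= -mulr_sumr.
by rewrite mulrDr mulrCA.
Qed.

Theorem theorem6p4 (R : realType) (q : nat) (V : choiceType) (adj : rel V)
    (s t : R) (f : nat -> V -> R[i]) :
  (1 <= q)%N ->
  homogeneous_tree q adj ->
  0 < s -> 0 < t -> s + t = 1 ->
  (forall k : nat, (1 <= k)%N ->
     mu1 q adj (f k) = s%:C *: f k.+1 + t%:C *: f k.-1) ->
  forall k : nat,
    f k = ((Num.sqrt (t / s))%:C ^+ k) *: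
      ((Num.sqrt (s / t))%:C *:
         poly_op (chebU (k%:Z - 1))
           (fun g : V -> R[i] => ((2 * Num.sqrt (s * t))^-1)%:C *: mu1 q adj g)
           (f 1%N)
       - poly_op (chebU (k%:Z - 2))
           (fun g : V -> R[i] => ((2 * Num.sqrt (s * t))^-1)%:C *: mu1 q adj g)
           (f 0%N)).
Proof.
move=> _ [_ deg_adj] s_gt0 t_gt0 _ epd k.
have fin_nbh v : finite_set (neighbors adj v) by exists q.+1; exact: deg_adj.
set c := ((2 * Num.sqrt (s * t))^-1)%:C; set T := fun g => c *: _.
have T_lin : linear T.
  move=> a g h; apply/funext => v.
  have mu1E : mu1 q adj (a *: g + h) v = a * mu1 q adj g v + mu1 q adj h v.
    exact: mu1_linear.
  by rewrite /T !fctE mu1E /GRing.scale /=; ring.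
(* Linearity rests on the finiteness of neighbourhoods in this tree, so the structure is built
   locally from [T_lin]. *)
pose TM := GRing.isLinear.Build _ _ _ _ T T_lin.
pose TL : {linear (V -> R[i]) -> (V -> R[i])} := HB.pack T TM.
set a := (Num.sqrt (t / s))%:C; set b := (Num.sqrt (s / t))%:C.
have ab1 : a * b = 1.
  rewrite -rmorphM /= -sqrtrM ?divr_ge0 ?ltW //.
  by rewrite mulrA divfK ?gt_eqF // divff ?gt_eqF // sqrtr1.
have bbs : b ^+ 2 * t%:C = s%:C.
  by rewrite -rmorphXn -rmorphM /= sqr_sqrtr ?divr_ge0 ?ltW // divfK ?gt_eqF.
have cs : c * s%:C *+ 2 = b.
  rewrite -rmorphM -rmorphMn /=; congr (_%:C).
  rewrite sqrtrM ?(ltW s_gt0) // sqrtrM ?(ltW s_gt0) // sqrtrV ?(ltW t_gt0) //.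
  (* Only the [s] outside the square roots becomes a square, leaving [field] an identity in sqrt(s)
     and sqrt(t). *)
  rewrite -{2}(sqr_sqrtr (ltW s_gt0)).
  have s'_neq0 : Num.sqrt s != 0 by rewrite gt_eqF ?sqrtr_gt0.
  have t'_neq0 : Num.sqrt t != 0 by rewrite gt_eqF ?sqrtr_gt0.
  by field; rewrite s'_neq0 t'_neq0.
(* After multiplication by b, the relation b^2 t = s reduces this to [cs]. *)
have bct : b * (c * t%:C) *+ 2 = 1.
  have b_neq0 : b != 0.
    by apply: contra_eq_neq ab1 => ->; rewrite mulr0 eq_sym oner_neq0.
  by apply: (mulfI b_neq0); rewrite mulr1 -[RHS]cs -bbs; ring.
have f_rec j : TL (f j.+1) = (c * s%:C) *: f j.+2 + (c * t%:C) *: f j.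
  by rewrite /= /T epd // scalerDr !scalerA.
(* The bracket equals b^k f_k, and a^k undoes the rescaling since ab = 1. *)
have <- := euler_poisson_darboux _ _ TL _ _ _ _ cs bct f_rec k.
by rewrite scalerA -exprMn ab1 expr1n scale1r.
Qed.
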